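(* Let $\Omega$ be a Riemannian manifold with Riemannian distance $d$. Let $\mu,\nu$ be two Borel probability measures on $\Omega$, absolutely continuous with respect to the Lebesgue (Riemannian volume) measure, with $\int_\Omega d(\cdot,\omega_0)\,d\mu<\infty$ and $\int_\Omega d(\cdot,\omega_0)\,d\nu<\infty$ for some (equivalently any) $\omega_0\in\Omega$. Let $v:\Omega\to\mathbb{R}$ be an optimal potential for the transport between $\mu$ and $\nu$, that is, a $1$-Lipschitz function attaining $$\sup\Big\{\int_\Omega u\,d(\nu-\mu)\;\Big|\;u:\Omega\to\mathbb{R}\text{ is }1\text{-Lipschitz}\Big\}.$$ Let $$\mathcal{F}=\{\lambda(v-u)\mid\lambda\ge0,\ u:\Omega\to\mathbb{R}\text{ is }1\text{-Lipschitz}\}\subset L^1(\Omega,\mu+\nu),$$ and let $\mathrm{cl}$ denote closure in $L^1(\Omega,\mu+\nu)$. Let $\mathcal{A}$ be the space of all Borel measurable functions, integrable with respect to $\mu+\nu$, that are constant on transport rays of $v$. Then the maximal linear subspace $\mathcal{B}\subset\mathrm{cl}\,\mathcal{F}$ of Borel measurable functions in $L^1(\Omega,\mu+\nu)$ contains $\mathcal{A}$. Moreover, $$\mathrm{cl}\big(\mathcal{F}\cap(-\mathcal{F})\big)\subset\mathcal{A}.$$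
   Context: A transport ray of a $1$-Lipschitz function $v:\Omega\to\mathbb{R}$ is a maximal (with respect to inclusion) set $\mathcal{T}\subset\Omega$ such that $|v(\omega_1)-v(\omega_2)|=d(\omega_1,\omega_2)$ for all $\omega_1,\omega_2\in\mathcal{T}$. Functions are identified with their classes in $L^1(\Omega,\mu+\nu)$; the maximal linear subspace of the convex cone $\mathrm{cl}\,\mathcal{F}$ is $\mathrm{cl}\,\mathcal{F}\cap(-\mathrm{cl}\,\mathcal{F})$.
   Formalization: ''Constant on transport rays'' is read as constant on every ray outside one (μ+ν)-null set, since for classes in L¹ the second inclusion fails if a representative must be constant on whole rays (rays may share an endpoint off the supports, e.g. v=|x| on R²). *)

(* Defs.v *)
From HB Require Import structures.
From mathcomp Require Import all_boot all_order all_algebra.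
From mathcomp Require Import all_classical all_reals all_analysis.

Set Implicit Arguments.
Unset Strict Implicit.
Unset Printing Implicit Defensive.

Import Order.TTheory GRing.Theory Num.Theory.
Import numFieldNormedType.Exports.

Local Open Scope classical_set_scope.
Local Open Scope ring_scope.

(* Pointed because measurable types are pointed; the spaces considered carry
   probability measures, hence are nonempty. *)
#[short(type="pmetricType")]
HB.structure Definition PointedMetric (K : numDomainType) :=
  {M of Metric K M & isPointed M}.

(* For U open: all partial derivatives of order at most k exist and are
   continuous on U. *)
Fixpoint Ck_on (R : realType) (m : nat) (V : normedModType R) (k : nat)
    (U : set 'rV[R]_m) (f : 'rV[R]_m -> V) : Prop :=
  (forall x, U x -> {for x, continuous f}) /\
  match k with
  | 0 => True
  | k'.+1 => forall j : 'I_m,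
      (forall x, U x -> derivable f x (delta_mx 0 j)) /\
      Ck_on k' U (fun x => 'D_(delta_mx 0 j) f x)
  end.

Definition smooth_on (R : realType) (m : nat) (V : normedModType R)
    (U : set 'rV[R]_m) (f : 'rV[R]_m -> V) : Prop :=
  forall k, Ck_on k U f.

(* Tangent vectors are row vectors of chart coordinates; [rmetric i x] is the
   Gram matrix of the Riemannian metric in the chart [i] at the coordinates [x].
   The transition from chart [i] to chart [j] sends a tangent vector [w] to
   [w *m jacobian _ _], which is the convention used in [rmetric_compat]. *)
Record riemannian_atlas (R : realType) (n : nat) (T : topologicalType) := {
  chart_index : Type;
  chart_dom : chart_index -> set T;
  chart : chart_index -> T -> 'rV[R]_n;
  chart_inv : chart_index -> 'rV[R]_n -> T;
  chart_at : T -> chart_index;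
  rmetric : chart_index -> 'rV[R]_n -> 'M[R]_n;
  chart_atP : forall p, chart_dom (chart_at p) p;
  chart_dom_open : forall i, open (chart_dom i);
  chart_codom_open : forall i, open (chart i @` chart_dom i);
  chartK : forall i p, chart_dom i p -> chart_inv i (chart i p) = p;
  chart_continuous : forall i p, chart_dom i p -> {for p, continuous (chart i)};
  chart_inv_continuous : forall i x, (chart i @` chart_dom i) x ->
    {for x, continuous (chart_inv i)};
  transition_smooth : forall i j,
    smooth_on (chart i @` (chart_dom i `&` chart_dom j))
              (chart j \o chart_inv i);
  rmetric_smooth : forall i, smooth_on (chart i @` chart_dom i) (rmetric i);
  rmetric_sym : forall i p, chart_dom i p ->
    (rmetric i (chart i p))^T = rmetric i (chart i p);
  rmetric_pos : forall i p, chart_dom i p -> forall w : 'rV[R]_n, w != 0 ->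
    0 < (w *m rmetric i (chart i p) *m w^T) 0 0;
  rmetric_compat : forall i j p, chart_dom i p -> chart_dom j p ->
    let J := jacobian (chart j \o chart_inv i) (chart i p) in
    rmetric i (chart i p) = J *m rmetric j (chart j p) *m J^T
}.

Arguments chart_dom {R n T} r i : rename.
Arguments chart {R n T} r i x : rename.
Arguments chart_inv {R n T} r i x : rename.
Arguments chart_at {R n T} r x : rename.
Arguments rmetric {R n T} r i x : rename.

Section curves.
Context (R : realType) (n : nat) (T : topologicalType).
Variable M : riemannian_atlas R n T.

(* Continuously differentiable on a neighbourhood of [0, 1]. *)
Definition C1_curve (c : R -> T) : Prop :=
  forall t : R, t \in `[0, 1] -> forall i, chart_dom M i (c t) ->
    \forall s \near t, [/\ {for s, continuous c},
      derivable (chart M i \o c) s 1 &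
      {for s, continuous (derive1 (chart M i \o c))}].

(* By [rmetric_compat] the choice of the chart at [c t] is immaterial. *)
Definition speed (c : R -> T) (t : R) : R :=
  let i := chart_at M (c t) in
  let w := derive1 (chart M i \o c) t in
  Num.sqrt ((w *m rmetric M i (chart M i (c t)) *m w^T) 0 0).

Definition curve_length (c : R -> T) : \bar R :=
  (\int[lebesgue_measure]_(t in `[0%R, 1%R]) (speed c t)%:E)%E.

(* The infimum of the empty set is +oo. *)
Definition riemannian_dist (x y : T) : \bar R :=
  ereal_inf [set curve_length c | c in
    [set c | [/\ C1_curve c, c 0 = x & c 1 = y]]].

End curves.

(* A Riemannian manifold, seen as a metric space with its Riemannian distance.
   The topology of [T] is that of [mdist], so it is Hausdorff; as [mdist] is
   finite, any two points are joined by a curve, so [T] is connected. *)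
Record riemannian_manifold (R : realType) (n : nat) (T : pmetricType R) := {
  atlas :> riemannian_atlas R n T;
  manifold_second_countable : @second_countable T;
  mdistE : forall x y : T, (mdist x y)%:E = riemannian_dist atlas x y
}.

Definition borel (T : ptopologicalType) := g_sigma_algebraType (@open T).

(* Iterated Lebesgue integral over R^n, that is (Tonelli) the integral with
   respect to n-dimensional Lebesgue measure when F is Borel and nonnegative. *)
Fixpoint integral_rV (R : realType) (n : nat) :
    ('rV[R]_n -> \bar R) -> \bar R :=
  match n with
  | 0 => fun F => F 0
  | n'.+1 => fun F => (\int[lebesgue_measure]_x
      integral_rV (fun y : 'rV[R]_n' => F (row_mx (x%:M : 'M[R]_1) y)))%E
  end.

(* This determines [vol], as T is covered by countably many charts. *)
Definition riemannian_volume (R : realType) (n : nat) (T : pmetricType R)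
    (M : riemannian_manifold n T)
    (vol : {measure set (borel T) -> \bar R}) : Prop :=
  forall i (E : set (borel T)), measurable E -> E `<=` chart_dom M i ->
    vol E = integral_rV (fun x =>
      (\1_(chart M i @` E) x * Num.sqrt (\det (rmetric M i x)))%:E).

Section potentials.
Context (R : realType) (T : pmetricType R).

Definition lip1 (u : T -> R) : Prop :=
  forall x y, `|u x - u y| <= mdist x y.

Definition optimal_potential (mu nu : {measure set (borel T) -> \bar R})
    (v : T -> R) : Prop :=
  let J u := (\int[nu]_x (u x)%:E - \int[mu]_x (u x)%:E)%E in
  lip1 v /\ J v = ereal_sup [set J u | u in lip1].

Definition isometric_on (v : T -> R) (S : set T) : Prop :=
  forall x y, S x -> S y -> `|v x - v y| = mdist x y.

Definition transport_ray (v : T -> R) (S : set T) : Prop :=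
  isometric_on v S /\
  forall S', S `<=` S' -> isometric_on v S' -> S' = S.

End potentials.

(* A subset of L^1(m) is represented by the set of all Borel functions whose
   class belongs to it; all the sets below are stable under a.e. equality. *)
Section L1.
Context (R : realType) (T : pmetricType R).
Variable m : {measure set (borel T) -> \bar R}.

Definition L1 : set (borel T -> R) := [set f | f \in Lfun m 1%E].

Definition cl (S : set (borel T -> R)) : set (borel T -> R) :=
  [set f | L1 f /\ forall e : R, 0 < e ->
    exists2 g, S g & ('N[m]_1 [EFin \o (f \- g)%R] < e%:E)%E].

Definition opp_set (S : set (borel T -> R)) : set (borel T -> R) :=
  [set f | S (\- f)].

Definition coneF (v : T -> R) : set (borel T -> R) :=
  [set f | L1 f /\ exists (l : R) (u : T -> R), [/\ 0 <= l, lip1 u &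
    (f = (fun x => l * (v x - u x)) %[ae m])]].

(* The maximal linear subspace of the convex cone cl F. *)
Definition spaceB (v : T -> R) : set (borel T -> R) :=
  cl (coneF v) `&` opp_set (cl (coneF v)).

(* As elements of L^1 are classes, constancy on the transport rays is required
   off a single null set. Requiring a representative constant on the whole of
   every ray would be too strong: many rays may share an endpoint lying outside
   the supports, e.g. the origin for v = |x| on R^n. *)
Definition spaceA (v : T -> R) : set (borel T -> R) :=
  [set f | L1 f /\ exists2 N : set (borel T), m.-negligible N &
    forall S, transport_ray v S ->
      forall x y, (S `\` N) x -> (S `\` N) y -> f x = f y].

End L1.

(* Main.v *)
(* Constancy on rays means f x = f y whenever |v x - v y| = d(x, y), since by
   Zorn such a pair lies on a ray.  If f = l (v - u) with u 1-Lipschitz and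
   v x - v y = d(x, y), then f x >= f y; hence an element of F and -F is constant
   on rays off a null set, and so are L^1-limits (along a summable subsequence).

   Conversely let E be a Borel set which, off a null set, is a union of rays.
   The manifold is sigma-compact, so E and its complement are exhausted, up to
   small measure, by compact sets K1 and K0.  The gap d(x, y) - v x + v y is
   positive on K0 x K1, hence at least some c > 0 by compactness, and
   u = min(v, inf_{y in K1} (v y + d(., y)) - c) is 1-Lipschitz, with (v - u) / c
   between 0 and 1, equal to 1 on K1 and to 0 on K0.  Thus the indicator of E is
   in cl F.  Constants lie in F, so minus the indicator, that of the complement
   minus 1, is in cl F as well; linear combinations, bounded functions and
   truncations then give all of A. *)

Require Import Defs.
From HB Require Import structures.
From mathcomp Require Import all_boot all_order all_algebra.
From mathcomp Require Import all_classical all_reals all_analysis.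

From mathcomp Require Import measurable_realfun ring lra.

Set Implicit Arguments.
Unset Strict Implicit.
Unset Printing Implicit Defensive.

Import Order.TTheory GRing.Theory Num.Theory.
Import numFieldNormedType.Exports.

Local Open Scope classical_set_scope.
Local Open Scope ring_scope.

(** * Inner regularity by compact sets *)

Section regularity.
Context (R : realType) (T : pmetricType R).
Variable m : {finite_measure set (borel T) -> \bar R}.

Lemma borel_open (U : set (borel T)) : open (U : set T) -> measurable U.
Proof. by move=> oU; exact: sub_sigma_algebra. Qed.

Lemma borel_closed (U : set (borel T)) : closed (U : set T) -> measurable U.
Proof.
move=> cU; rewrite -(setCK U); apply: measurableC; apply: borel_open.
exact: closed_openC.
Qed.

Lemma borel_compact (K : set (borel T)) : compact (K : set T) -> measurable K.
Proof.
move=> cK; apply: borel_closed.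
exact: (compact_closed (@metric_hausdorff _ T)).
Qed.

(** Continuity from above, available because [m] is finite. *)
Lemma small_of_empty_cap (G : (set (borel T))^nat) (e : R) :
  (forall k, measurable (G k)) -> nonincreasing_seq G -> \bigcap_k G k = set0 ->
  0 < e -> exists k, (m (G k) < e%:E)%E.
Proof.
move=> mG dG G0 e0.
have h : m \o G @ \oo --> 0%E.
  rewrite -(measure0 m) -G0; apply: nonincreasing_cvg_mu => //.
    by rewrite ltey_eq fin_num_measure.
  by rewrite G0.
have /fine_cvgP[_ /cvgrPdist_lt /(_ _ e0)[k _ /(_ k (leqnn k))]] := h.
rewrite /= sub0r normrN ger0_norm ?fine_ge0// => hk.
by exists k; rewrite -[ltLHS]fineK ?lte_fin// fin_num_measure.
Qed.

(** Inner regularity is asked of [E] and of its complement at once. This symmetric form passes to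
    complements for free, so the bracketed sets can be shown to form a sigma-algebra. *)
Definition compact_bracket (E : set (borel T)) := forall e : R, 0 < e ->
  exists K K' : set T, [/\ compact K, compact K', K `<=` E, K' `<=` ~` E &
    (m (~` (K `|` K') : set (borel T)) < e%:E)%E].

Lemma compact_bracketC E : compact_bracket E -> compact_bracket (~` E).
Proof.
move=> bE e /bE[K [K' [cK cK' KE K'E mKK']]]; exists K', K.
by rewrite setCK setUC.
Qed.

Lemma compact_bracket_bigcup (E : (set (borel T))^nat) :
  (forall i, compact_bracket (E i)) -> compact_bracket (\bigcup_i E i).
Proof.
move=> bE e e0.
(* Half of [e] is shared among the brackets of the [E i]; the other half pays for cutting the union
   of the [K i] down to a finite one, as compactness demands. *)
have e20 i : 0 < e / 2 / (2 ^ i.+1)%:R by rewrite !divr_gt0// ltr0n expn_gt0.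
have /choice[K /choice[K' KK']] := fun i => bE i _ (e20 i).
have cK i : compact (K i) by case: (KK' i).
have cK' i : compact (K' i) by case: (KK' i).
have mK i : measurable (K i : set (borel T)) by exact: borel_compact.
have mK' i : measurable (K' i : set (borel T)) by exact: borel_compact.
pose B : set (borel T) := \bigcup_i ~` (K i `|` K' i).
pose G n : set (borel T) := (\bigcup_i K i) `\` \big[setU/set0]_(i < n) K i.
have mB : measurable B.
  by apply: bigcupT_measurable => i; apply: measurableC; apply: measurableU.
have mG n : measurable (G n).
  apply: measurableD; first exact: bigcupT_measurable.
  exact: bigsetU_measurable.
have [||n Gn] := @small_of_empty_cap G (e / 2) mG _ _ (divr_gt0 e0 (ltr0n _ 2)).
- by move=> i j ij; apply/subsetPset; apply: setDS; exact: subset_bigsetU.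
- rewrite -subset0 => x Gx; have [[i _ Kix] _] := Gx 0%N I.
  have [_] := Gx i.+1 I; apply.
  by rewrite -bigcup_mkord; exists i => /=.
exists (\big[setU/set0]_(i < n) K i), (\bigcap_i K' i); split.
- exact: bigsetU_compact.
(* The infinite intersection is compact as a closed subset of [K' 0]. *)
- rewrite -(@setIidr _ (K' 0%N) (\bigcap_i K' i)); last exact: bigcap_inf.
  apply: compact_closedI => //; apply: closed_bigI => i _.
  exact: (compact_closed (@metric_hausdorff _ T)).
- rewrite -bigcup_mkord => x [i _ Kix]; exists i => //.
  by case: (KK' i) => _ _ + _ _; exact.
- move=> x K'x [i _ Eix].
  by case: (KK' i) => _ _ _ /(_ x (K'x i I)) + _; exact.
(* A point left out misses some [K' i]. If it lies in [K i] it belongs to the tail [G n]; otherwise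
   it escapes the [i]-th bracket and belongs to [B]. *)
have sub : (~` (\big[setU/set0]_(i < n) K i `|` \bigcap_i K' i) : set (borel T))
    `<=` B `|` G n.
  move=> x; rewrite setCU => -[nK nK'].
  have [i nK'i] : exists i, ~ K' i x.
    by apply/existsNP => K'x; apply: nK' => i _; exact: K'x.
  have [Kix|nKix] := pselect (K i x); first by right; split => //; exists i.
  by left; exists i => // -[].
have mBe : (m B <= (e / 2)%:E)%E.
  apply: le_trans (epsilon_trick0 xpredT (ltW (divr_gt0 e0 (ltr0n _ 2)))).
  have sB : (m B <= \sum_(i <oo) m (~` (K i `|` K' i) : set (borel T)))%E.
    apply: (measure_sigma_subadditive m) => //.
    by move=> i; apply: measurableC; apply: measurableU.
  apply: le_trans sB _; apply: lee_nneseries => [//|i _].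
  by case: (KK' i) => _ _ _ _ /ltW.
have mS : measurable (~` (\big[setU/set0]_(i < n) K i `|` \bigcap_i K' i)
    : set (borel T)).
  apply: measurableC; apply: measurableU; first exact: bigsetU_measurable.
  exact: bigcapT_measurable.
apply: (@le_lt_trans _ _ (m (B `|` G n))).
  by apply: le_measure sub; rewrite inE//; exact: measurableU.
apply: (@le_lt_trans _ _ (m B + m (G n))%E); first exact: measureU2.
rewrite [e in ltRHS]splitr EFinD.
by apply: lee_ltD => //; exact: fin_num_measure.
Qed.

Definition sigma_compact := exists2 C : (set T)^nat,
  forall k, compact (C k) & \bigcup_k C k = setT.

Hypothesis sT : sigma_compact.

(** In a metric space an open set is an increasing union of closed sets, here the [F k] of points at
    distance at least [1 / (k + 1)] from every point outside [U]. Cutting [F k] and the complement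
    of [U] by a compact exhaustion [D k] gives the brackets. *)
Lemma compact_bracket_open (U : set (borel T)) :
  open (U : set T) -> compact_bracket U.
Proof.
move=> oU e e0; have [C cC CT] := sT.
pose D k := \big[setU/set0]_(i < k.+1) C i.
pose F k : set T := ~` \bigcup_(x in ~` U) ball x k.+1%:R^-1.
have cD k : compact (D k) by exact: bigsetU_compact.
have clF k : closed (F k).
  rewrite closedC; apply: bigcup_open => x _; rewrite ballEmdist.
  rewrite openE => y /= xy.
  have dxy : 0 < k.+1%:R^-1 - mdist x y by rewrite subr_gt0.
  apply/nbhs_ballP; exists (k.+1%:R^-1 - mdist x y) => //= z.
  rewrite ballEmdist /= ltrBrDl; apply: le_lt_trans; exact: metric_triangle.
have clU : closed (~` U : set T) by rewrite closedC.
pose K k := D k `&` F k.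
pose K' k := D k `&` ~` U.
have cK k : compact (K k) by exact: compact_closedI.
have cK' k : compact (K' k) by exact: compact_closedI.
have FU k : F k `<=` U.
  move=> x Fx; apply: contrapT => Ux; apply: Fx; exists x => //.
  by apply: ballxx; rewrite invr_gt0.
have [|||k mk] := @small_of_empty_cap (fun k => ~` (K k `|` K' k)) e _ _ _ e0.
- by move=> k; apply: measurableC; apply: measurableU; exact: borel_compact.
- move=> i j ij; apply/subsetPset; apply: subsetC.
  have Dij : D i `<=` D j by exact: subset_bigsetU.
  apply: setUSS; first apply: setISS => //; last exact: setSI.
  apply: subsetC; apply: subset_bigcup => x _; apply: le_ball.
  by rewrite lef_pV2 ?posrE// ler_nat.
- rewrite -subset0 => x h.
  have [i _ Cix] : (\bigcup_k C k) x by rewrite CT.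
  have Dx j : (i <= j)%N -> D j x.
    by move=> ij; rewrite /D -bigcup_mkord; exists i.
  have [Ux|Ux] := pselect (U x); last first.
    by apply: (h i I); right; split => //; exact: Dx.
  have /nbhs_ballP[r /= r0 rU] : nbhs (x : T) U by exact: open_nbhs_nbhs.
  have [j jr] : exists j, j.+1%:R^-1 < r.
    by have [j _ /(_ j (leqnn j))] := near_infty_natSinv_lt (PosNum r0); exists j.
  (* The index [i] puts [x] in the exhaustion, and [j] makes the ball around [x] fit inside [U]. *)
  apply: (h (maxn i j) I); left; split; first by apply: Dx; exact: leq_maxl.
  move=> [y Uy xy]; apply: Uy; apply: rU; apply: ball_sym.
  apply: le_ball xy; apply: le_trans (ltW jr).
  by rewrite lef_pV2 ?posrE// ler_nat ltnS leq_maxr.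
by exists (K k), (K' k); split => //; move=> x [] // _ /FU.
Qed.

Lemma borel_compact_bracket (E : set (borel T)) :
  measurable E -> compact_bracket E.
Proof.
move: E; apply: smallest_sub; last exact: compact_bracket_open.
split.
- by apply: compact_bracket_open; exact: open0.
- by move=> A; rewrite setTD; exact: compact_bracketC.
- exact: compact_bracket_bigcup.
Qed.

End regularity.

(** * Sigma-compactness of manifolds *)

Lemma locally_compact_sigma_compact (R : realType) (T : pmetricType R) :
  @second_countable T -> (forall p : T, exists2 K, compact K & nbhs p K) ->
  sigma_compact T.
Proof.
move=> [B cB [_ bB]] lT.
have /pfcard_geP[B0|/unsquash f] := cB.
  have [K _ pK] := lT point.
  by have [b []] := bB _ _ pK; rewrite B0.
(* Each basic open set that lies in some compact set is assigned one, the others the empty set. By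
   local compactness the basic sets of the first kind already cover the space. *)
have /choice[C hC] : forall k, exists K : set T, compact K /\
    ((exists2 K', compact K' & f k `<=` K') -> f k `<=` K).
  move=> k; have [[K cK fK]|nK] := pselect (exists2 K', compact K' & f k `<=` K').
    by exists K.
  by exists set0; split => //; exact: compact0.
exists C => [k|]; first by case: (hC k).
rewrite -subTset => p _; have [K cK pK] := lT p.
have [b [Bb bp] bK] := bB _ _ pK.
have [k _ fkb] : (f @` setT) b by exact: surj.
by exists k => //; case: (hC k) => _; rewrite fkb; apply => //; exists K.
Qed.

Lemma manifold_sigma_compact (R : realType) (n : nat) (T : pmetricType R) :
  riemannian_manifold n T -> sigma_compact T.
Proof.
move=> M; apply: locally_compact_sigma_compact => [|p].
  exact: manifold_second_countable M.
set i := chart_at M p.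
have ip : chart_dom M i p by exact: chart_atP.
have /nbhs_ballP[r /= r0 rO] : nbhs (chart M i p) (chart M i @` chart_dom M i).
  by apply: open_nbhs_nbhs; split; [exact: chart_codom_open|exists p].
have r20 : 0 < r / 2 by exact: divr_gt0.
(* Halving the radius keeps the closed ball inside the open image of the chart; its preimage is then
   a compact neighbourhood of [p]. *)
pose B := closed_ball_ Num.norm (chart M i p) (r / 2).
have BO : B `<=` chart M i @` chart_dom M i.
  move=> x Bx; apply: rO; rewrite -ball_normE /ball_/=.
  by apply: le_lt_trans Bx _; rewrite ltr_pdivrMr// ltr_pMr// ltr1n.
exists (chart_inv M i @` B).
  apply: continuous_compact.
    by apply: continuous_in_subspaceT => x /set_mem /BO; exact: chart_inv_continuous.
  apply: bounded_closed_compact; last exact: closed_closed_ball_.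
  exists (`|chart M i p| + r / 2); split; first exact: num_real.
  move=> y yr x Bx; apply/ltW; apply: le_lt_trans yr.
  rewrite -[x](subrK (chart M i p)) addrC (le_trans (ler_normD _ _))// lerD2l.
  by rewrite distrC.
have : nbhs p (chart M i @^-1` ball (chart M i p) (r / 2)).
  by apply: (chart_continuous ip); exact: nbhsx_ballx.
have : nbhs p (chart_dom M i).
  by apply: open_nbhs_nbhs; split => //; exact: chart_dom_open.
apply: filterS2 => q iq qr; exists (chart M i q); last exact: chartK.
by move: qr; rewrite /= -ball_normE => /ltW.
Qed.

(** * Lipschitz functions and transport rays *)

Section lipschitz.
Context (R : realType) (T : pmetricType R).
Implicit Types (u v : T -> R) (x y : T).

Lemma lip1P u : (forall x y, u x <= u y + mdist x y) -> lip1 u.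
Proof.
move=> h x y; have := h x y; have := h y x; rewrite (metric_sym y x).
by rewrite ler_norml => *; apply/andP; split; lra.
Qed.

Lemma lip1_le u x y : lip1 u -> u x <= u y + mdist x y.
Proof. by move=> /(_ x y); rewrite ler_norml => /andP[_]; rewrite lerBlDl. Qed.

Lemma continuous_mdist : continuous (fun p : T * T => mdist p.1 p.2).
Proof.
move=> [x y]; apply/cvgrPdist_lt => e e0.
have e20 : 0 < e / 2 by exact: divr_gt0.
exists (ball x (e / 2), ball y (e / 2)).
  by split; exact: nbhsx_ballx.
move=> [x' y'] /= []; rewrite !ballEmdist /= => xx' yy'.
rewrite ltr_norml [e in X in X && _]splitr [e in X in _ && X]splitr.
have := metric_triangle x x' y; have := metric_triangle x' y' y.
have := metric_triangle x' x y'; have := metric_triangle x y y'.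
rewrite (metric_sym x' x) (metric_sym y' y).
by move=> *; apply/andP; split; lra.
Qed.

Lemma lip1_continuous u : lip1 u -> continuous u.
Proof.
move=> lu x; apply/cvgrPdist_lt => e e0; apply/nbhs_ballP; exists e => //= y.
by rewrite ballEmdist; exact: le_lt_trans.
Qed.

Lemma continuous_borel_measurable u :
  continuous u -> measurable_fun setT (u : borel T -> R).
Proof.
move=> cu; apply: (measurability _ (RGenOInfty.measurableE R)).
move=> _ [_ [a ->] <-]; rewrite setTI; apply: borel_open.
by apply: open_comp => [x _|]; [exact: cu|exact: interval_open].
Qed.

Lemma lip1_min u v : lip1 u -> lip1 v -> lip1 (fun x => Num.min (u x) (v x)).
Proof.
move=> lu lv; apply: lip1P => x y; rewrite addr_minl le_min !ge_min.
by rewrite !lip1_le// orbT.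
Qed.

Lemma lip1D_cst u c : lip1 u -> lip1 (fun x => u x + c).
Proof. by move=> lu x y; rewrite opprD addrACA subrr addr0; exact: lu. Qed.

(** Each cone [v y + mdist x y] is 1-Lipschitz in [x] and lies above [v x], so the infimum is finite
    and inherits the bound. *)
Lemma lip1_cone v (K : set T) : lip1 v -> K !=set0 ->
  lip1 (fun x => inf [set v y + mdist x y | y in K]).
Proof.
move=> lv [y0 Ky0]; apply: lip1P => x y.
rewrite -lerBlDr; apply: lb_le_inf; first by exists (v y0 + mdist y y0), y0.
move=> _ [z Kz <-]; rewrite lerBlDr.
apply: (@le_trans _ _ (v z + mdist x z)).
  apply: ge_inf; last by exists z.
  by exists (v x) => _ [w _ <-]; exact: lip1_le.
by rewrite -addrA lerD2l [leRHS]addrC metric_triangle.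
Qed.

(* [v - u] is a multiple of a Urysohn function for the pair [K1], [K0]: the
   envelope of the cones based on [K1] lies above [v], touches it on [K1], and
   lies above [v + d] on [K0]. *)
Lemma lip1_urysohn v (K1 K0 : set T) (d : R) : lip1 v -> 0 < d ->
  (forall x y, K0 x -> K1 y -> d <= mdist x y - v x + v y) ->
  exists u, [/\ lip1 u, forall x, v x - d <= u x <= v x,
    forall x, K1 x -> u x = v x - d & forall x, K0 x -> u x = v x].
Proof.
(* For empty [K1] the infimum would only be a default value, and [u = v] works. *)
move=> lv d0 hd; have [K10|K10] := pselect (K1 !=set0); last first.
  exists v; split => //; first by move=> x; rewrite lexx gerBl ltW.
  by move=> x K1x; exfalso; apply: K10; exists x.
pose h x := inf [set v y + mdist x y | y in K1].
have ne x : [set v y + mdist x y | y in K1] !=set0.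
  by case: K10 => y K1y; exists (v y + mdist x y), y.
have vh x : v x <= h x.
  by apply: lb_le_inf => // _ [w _ <-]; exact: lip1_le.
have lh : lip1 (fun x => h x - d) by apply: lip1D_cst; exact: lip1_cone.
exists (fun x => Num.min (v x) (h x - d)); split.
- exact: lip1_min.
- by move=> x; rewrite le_min ge_min lexx lerD2r vh gerBl ltW.
- move=> x K1x; suff -> : h x = v x by apply/min_idPr; rewrite gerBl ltW.
  apply/le_anti; rewrite vh andbT; apply: ge_inf.
    by exists (v x) => _ [w _ <-]; exact: lip1_le.
  by exists x => //; rewrite mdistxx addr0.
- move=> x K0x; apply/min_idPl; rewrite lerBrDr.
  apply: lb_le_inf => // _ [y K1y <-].
  by have := hd _ _ K0x K1y; lra.
Qed.

End lipschitz.

(** * Rays through pairs of points *)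

Section rays.
Context (R : realType) (T : pmetricType R) (v : T -> R).

Lemma transport_ray_pair x y : `|v x - v y| = mdist x y ->
  exists S, [/\ transport_ray v S, S x & S y].
Proof.
(* Adjoining the pair inside the predicate lets Zorn's lemma apply even to the empty chain. The ray
   is then a maximal [A] together with the pair. *)
move=> vxy; pose P (A : set T) := isometric_on v (A `|` [set x; y]).
have Pxy : isometric_on v [set x; y].
  move=> _ _ [->|->] [->|->] //; rewrite ?subrr ?normr0 ?mdistxx//.
  by rewrite distrC metric_sym.
have [|A [PA maxA]] := @Zorn_bigcup _ P.
  move=> F FP totF a b [[X FX Xa]|xya] [[Y FY Yb]|xyb]; last exact: Pxy.
  - have [XY|YX] := totF _ _ FX FY.
      by apply: (FP _ FY); left => //; exact: XY.
    by apply: (FP _ FX); left => //; exact: YX.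
  - by apply: (FP _ FX); [left|right].
  - by apply: (FP _ FY); [right|left].
exists (A `|` [set x; y]); split; [split => //|by right; left|by right; right].
move=> S' AS' iS'; apply/seteqP; split => //.
have AS : A `<=` S' by move=> z Az; apply: AS'; left.
have S'A : S' `<=` A.
  apply: contrapT => nS'A; apply: (maxA S'); first by split.
  suff : S' `|` [set x; y] = S' by rewrite /P => ->.
  by apply/setUidPl => z xyz; apply: AS'; right.
by move=> z /S'A; left.
Qed.

(** A two-point form of constancy on rays, free of any mention of maximality; [N] is the exceptional
    set. *)
Definition ray_constant (N : set T) (f : T -> R) := forall x y, ~ N x -> ~ N y ->
  `|v x - v y| = mdist x y -> f x = f y.

Lemma spaceA_ray_constant (m : {measure set (borel T) -> \bar R}) f :
  spaceA m v f <-> L1 m f /\ exists2 N, m.-negligible N & ray_constant N f.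
Proof.
split=> -[Lf [N nN hN]]; split => //; exists N => //.
  move=> x y Nx Ny /transport_ray_pair[S [rS Sx Sy]].
  by apply: (hN S).
move=> S [iS _] x y [Sx Nx] [Sy Ny].
by apply: hN => //; exact: iS.
Qed.

End rays.

(** * Closures in L1 *)

Section L1_space.
Context (R : realType) (T : pmetricType R).
Variable m : {finite_measure set (borel T) -> \bar R}.
Implicit Types (f g : borel T -> R) (S : set (borel T -> R)).

Lemma L1_integrable f : L1 m f <-> m.-integrable setT (EFin \o f).
Proof. exact: Lfun1_integrable. Qed.

Lemma L1_measurable f : L1 m f -> measurable_fun setT f.
Proof. by move=> /L1_integrable /measurable_int /measurable_EFinP. Qed.

Lemma L1D f g : L1 m f -> L1 m g -> L1 m (f \+ g).
Proof.
move=> /L1_integrable If /L1_integrable Ig; apply/L1_integrable.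
exact: (integrableD measurableT If Ig).
Qed.

Lemma L1Z (c : R) f : L1 m f -> L1 m (fun x => c * f x).
Proof.
move=> /L1_integrable If; apply/L1_integrable.
exact: (integrableZl measurableT c If).
Qed.

Lemma L1N f : L1 m f -> L1 m (\- f).
Proof.
move=> /L1_integrable If; apply/L1_integrable.
exact: (integrableN If).
Qed.

Lemma L1_bounded f (c : R) : measurable_fun setT f -> (forall x, `|f x| <= c) ->
  L1 m f.
Proof.
move=> mf fc; apply/L1_integrable.
apply: (le_integrable measurableT _ _ (finite_measure_integrable_cst m c measurableT)) => //.
  exact/measurable_EFinP.
by move=> x _ /=; rewrite lee_fin (le_trans (fc x))// ler_norm.
Qed.

(** The norm of [f - g] as a plain integral, so that pointwise inequalities can be integrated
    directly. *)
Definition L1dist f g : \bar R := (\int[m]_x `|f x - g x|%:E)%E.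

Lemma clE S f : cl m S f <-> L1 m f /\ forall e : R, 0 < e ->
  exists2 g, S g & (L1dist f g < e%:E)%E.
Proof.
by split=> -[Lf h]; split => // e /h[g Sg fg]; exists g => //; move: fg;
  rewrite Lnorm1.
Qed.

Lemma measurable_dist f g : measurable_fun setT f -> measurable_fun setT g ->
  measurable_fun setT (fun x => `|f x - g x|%:E).
Proof.
by move=> mf mg; apply/measurable_EFinP/measurableT_comp => //; exact: measurable_funB.
Qed.

Lemma L1dist_le f1 g1 f2 g2 : L1 m f1 -> L1 m g1 -> L1 m f2 -> L1 m g2 ->
  (forall x, `|f1 x - g1 x| <= `|f2 x - g2 x|) -> (L1dist f1 g1 <= L1dist f2 g2)%E.
Proof.
move=> Lf1 Lg1 Lf2 Lg2 h; apply: ge0_le_integral => //.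
- by apply: measurable_dist; exact: L1_measurable.
- by apply: measurable_dist; exact: L1_measurable.
- by move=> x _; rewrite lee_fin.
Qed.

Lemma L1dist_leD f g f1 g1 f2 g2 :
  L1 m f -> L1 m g -> L1 m f1 -> L1 m g1 -> L1 m f2 -> L1 m g2 ->
  (forall x, `|f x - g x| <= `|f1 x - g1 x| + `|f2 x - g2 x|) ->
  (L1dist f g <= L1dist f1 g1 + L1dist f2 g2)%E.
Proof.
move=> Lf Lg Lf1 Lg1 Lf2 Lg2 h; rewrite -ge0_integralD//; last 2 first.
- by apply: measurable_dist; exact: L1_measurable.
- by apply: measurable_dist; exact: L1_measurable.
apply: ge0_le_integral => //.
- by apply: measurable_dist; exact: L1_measurable.
- by apply: emeasurable_funD; apply: measurable_dist; exact: L1_measurable.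
- by move=> x _; rewrite -EFinD lee_fin.
Qed.

Lemma L1distZ (c : R) f g : L1 m f -> L1 m g ->
  (L1dist (fun x => c * f x)%R (fun x => c * g x)%R = (`|c|)%R%:E * L1dist f g)%E.
Proof.
move=> Lf Lg; rewrite -ge0_integralZl//.
  by apply: eq_integral => x _; rewrite -mulrBr normrM.
by apply: measurable_dist; exact: L1_measurable.
Qed.

Lemma sub_cl S f : S `<=` L1 m -> S f -> cl m S f.
Proof.
move=> SL Sf; apply/clE; split; first exact: SL.
move=> e e0; exists f => //; rewrite /L1dist.
by under eq_integral do rewrite subrr normr0; rewrite integral0 lte_fin.
Qed.

Lemma cl_closed S f : S `<=` L1 m -> L1 m f ->
  (forall e : R, 0 < e -> exists2 g, cl m S g & (L1dist f g < e%:E)%E) -> cl m S f.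
Proof.
move=> SL Lf h; apply/clE; split => // e e0.
have e20 : 0 < e / 2 by exact: divr_gt0.
have [g /clE[Lg /(_ _ e20)[k Sk gk]] fg] := h _ e20.
exists k => //; have Lk := SL _ Sk.
apply: le_lt_trans (L1dist_leD Lf Lk Lf Lg Lg Lk _) _.
  by move=> x; exact: ler_distD.
by rewrite [e in ltRHS]splitr EFinD lteD.
Qed.

(** * The cone, its closure and its lineality space *)

Section cone.
Variable v : T -> R.
Hypothesis lv : lip1 v.

Lemma coneF_L1 : coneF m v `<=` L1 m.
Proof. by move=> f []. Qed.

(** [l (v - u) + k (v - w)] equals [l + k] times [v] minus the weighted mean of [u] and [w], and
    such a mean is 1-Lipschitz. *)
Lemma coneFD f g : coneF m v f -> coneF m v g -> coneF m v (f \+ g).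
Proof.
move=> [Lf [l [u [l0 lu fE]]]] [Lg [k [w [k0 lw gE]]]].
split; first exact: L1D.
have [s0|s0] := eqVneq (l + k) 0.
  have [l00 k00] : l = 0 /\ k = 0 by split; lra.
  exists 0, v; split => //; near=> x.
  move=> _ /=; rewrite (near fE x)// (near gE x)// l00 k00.
  by rewrite !mul0r addr0.
have s1 : 0 < l + k by rewrite lt_neqAle eq_sym s0 addr_ge0.
exists (l + k), (fun x => (l * u x + k * w x) / (l + k)); split.
- exact: ltW.
- apply: lip1P => x y; rewrite ler_pdivrMr// mulrDl divfK//.
  have := ler_wpM2l l0 (lip1_le x y lu).
  have := ler_wpM2l k0 (lip1_le x y lw).
  by rewrite !mulrDr; lra.
- near=> x => _ /=; rewrite (near fE x)// (near gE x)//.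
  by field.
Unshelve. all: by end_near. Qed.

Lemma coneFZ (c : R) f : 0 <= c -> coneF m v f -> coneF m v (fun x => c * f x).
Proof.
move=> c0 [Lf [l [u [l0 lu fE]]]]; split; first exact: L1Z.
exists (c * l), u; split => //; first exact: mulr_ge0.
by near=> x => _ /=; rewrite (near fE x)// mulrA.
Unshelve. all: by end_near. Qed.

Lemma coneF_cst (c : R) : coneF m v (cst c).
Proof.
split; first by apply: (@L1_bounded _ `|c|).
exists 1, (fun x => v x - c); split => //; first exact: lip1D_cst.
by apply/nearW => x _ /=; rewrite mul1r opprB addrCA subrr addr0.
Qed.

Lemma cl_coneFD f g : cl m (coneF m v) f -> cl m (coneF m v) g ->
  cl m (coneF m v) (f \+ g).
Proof.
move=> /clE[Lf hf] /clE[Lg hg]; apply/clE; split; first exact: L1D.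
move=> e e0; have e20 : 0 < e / 2 by exact: divr_gt0.
have [f' Ff' ff'] := hf _ e20; have [g' Fg' gg'] := hg _ e20.
exists (f' \+ g'); first exact: coneFD.
have Lf' := coneF_L1 Ff'; have Lg' := coneF_L1 Fg'.
apply: le_lt_trans (L1dist_leD (L1D Lf Lg) (L1D Lf' Lg') Lf Lf' Lg Lg' _) _.
  by move=> x /=; rewrite opprD addrACA ler_normD.
by rewrite [e in ltRHS]splitr EFinD lteD.
Qed.

Lemma cl_coneFZ (c : R) f : 0 <= c -> cl m (coneF m v) f ->
  cl m (coneF m v) (fun x => c * f x).
Proof.
move=> c0 /clE[Lf hf]; apply/clE; split; first exact: L1Z.
(* Dividing by [c + 1] instead of [c] covers [c = 0]. *)
move=> e e0; have c10 : 0 < c + 1 by rewrite ltr_wpDl.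
have [g Fg fg] := hf _ (divr_gt0 e0 c10).
exists (fun x => c * g x); first exact: coneFZ.
rewrite L1distZ//; last exact: coneF_L1.
rewrite ger0_norm//; apply: (@le_lt_trans _ _ (c%:E * (e / (c + 1))%:E)%E).
  by apply: lee_wpmul2l; [rewrite lee_fin|exact: ltW].
rewrite -EFinM lte_fin mulrCA gtr_pMr// ltr_pdivrMr//.
by rewrite mul1r ltrDl.
Qed.

Lemma spaceB_L1 f : spaceB m v f -> L1 m f.
Proof. by move=> [[]]. Qed.

Lemma spaceBD f g : spaceB m v f -> spaceB m v g -> spaceB m v (f \+ g).
Proof.
move=> [f1 f2] [g1 g2]; split; first exact: cl_coneFD.
rewrite /opp_set/=; have -> : \- (f \+ g) = (\- f) \+ (\- g).
  by apply/funext => x /=; rewrite opprD.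
exact: cl_coneFD.
Qed.

(** A negative scalar exchanges the roles of [f] and [- f], both of which lie in the closed cone. *)
Lemma spaceBZ (c : R) f : spaceB m v f -> spaceB m v (fun x => c * f x).
Proof.
move=> [f1 f2]; have [c0|c0] := leP 0 c.
  split; first exact: cl_coneFZ.
  rewrite /opp_set/= (_ : \- _ = (fun x => c * (\- f) x)); first exact: cl_coneFZ.
  by apply/funext => x /=; rewrite mulrN.
have Nc0 : 0 <= - c by rewrite oppr_ge0 ltW.
split.
  rewrite (_ : (fun x => _) = (fun x => - c * (\- f) x)); first exact: cl_coneFZ.
  by apply/funext => x /=; rewrite mulrNN.
rewrite /opp_set/= (_ : \- _ = (fun x => - c * f x)); first exact: cl_coneFZ.
by apply/funext => x /=; rewrite mulNr.
Qed.

Lemma spaceB_cst (c : R) : spaceB m v (cst c).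
Proof.
split; first by apply: sub_cl; [exact: coneF_L1|exact: coneF_cst].
apply: sub_cl; first exact: coneF_L1.
exact: (coneF_cst (- c)).
Qed.

Lemma spaceB_closed f : L1 m f ->
  (forall e : R, 0 < e -> exists2 g, spaceB m v g & (L1dist f g < e%:E)%E) ->
  spaceB m v f.
Proof.
move=> Lf h; split; apply: cl_closed => //; first exact: coneF_L1.
- by move=> e /h[g [Bg _] fg]; exists g.
- exact: coneF_L1.
- exact: L1N.
- move=> e /h[g Bg fg]; have [_ ?] := Bg; exists (\- g) => //.
  apply: le_lt_trans fg; apply: L1dist_le => //.
  + exact: L1N.
  + exact/L1N/spaceB_L1.
  + exact: spaceB_L1.
  + by move=> x /=; rewrite -opprD normrN.
Qed.

End cone.
End L1_space.

(** * Ray-constant functions belong to the lineality space *)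

Section spaceA_sub_spaceB.
Context (R : realType) (T : pmetricType R).
Variables (m : {finite_measure set (borel T) -> \bar R}) (v : T -> R).
Hypotheses (sT : sigma_compact T) (lv : lip1 v).

(** [E] is a union of rays up to [N]; one implication suffices since the relation between [x] and
    [y] is symmetric. *)
Definition ray_invariant (N E : set T) := forall x y, ~ N x -> ~ N y ->
  `|v x - v y| = mdist x y -> E x -> E y.

Lemma ray_invariantC N E : ray_invariant N E -> ray_invariant N (~` E).
Proof.
move=> iE x y Nx Ny vxy nEx Ey; apply: nEx.
by apply: iE Ey => //; rewrite distrC metric_sym.
Qed.

Lemma compact_split (N E : set (borel T)) (e : R) :
  m.-negligible N -> measurable E -> 0 < e -> exists K1 K0 : set T,
  [/\ compact K1, compact K0, K1 `<=` E `\` N, K0 `<=` ~` E `\` N &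
    (m (~` (K1 `|` K0) : set (borel T)) < e%:E)%E].
Proof.
(* [N] need not be Borel, so the Borel null set [A] containing it is removed from [E] and from its
   complement before bracketing. *)
move=> [A [mA A0 NA]] mE e0; have e20 : 0 < e / 2 by exact: divr_gt0.
have [K1 [H1 [cK1 cH1 KE1 HE1 m1]]] :=
  borel_compact_bracket m sT (measurableD mE mA) e20.
have [K0 [H0 [cK0 cH0 KE0 HE0 m0]]] :=
  borel_compact_bracket m sT (measurableD (measurableC mE) mA) e20.
exists K1, K0; split => //.
- by move=> x /KE1[Ex Ax]; split => // /NA.
- by move=> x /KE0[Ex Ax]; split => // /NA.
have mU (K H : set (borel T)) : compact (K : set T) -> compact (H : set T) ->
    measurable (~` (K `|` H)).
  by move=> cK cH; apply: measurableC; apply: measurableU; exact: borel_compact.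
(* [H1] avoids [E] minus [A], and [H0] avoids the complement of [E] minus [A]; a point in both can
   only lie in [A]. *)
have sub : (~` (K1 `|` K0) : set (borel T)) `<=`
    (~` (K1 `|` H1) `|` ~` (K0 `|` H0)) `|` A.
  move=> x; rewrite setCU => -[nK1 nK0].
  have [H1x|H1x] := pselect (H1 x); last by left; left => -[].
  have [H0x|H0x] := pselect (H0 x); last by left; right => -[].
  right; apply: contrapT => nA; apply: (HE0 x H0x); split => // Ex.
  exact: (HE1 x H1x).
have := mU _ _ cK1 cH1; have := mU _ _ cK0 cH0; have := mU _ _ cK1 cK0.
move=> mK mS0 mS1.
have mS01 := measurableU _ _ mS1 mS0.
apply: (@le_lt_trans _ _ (m ((~` (K1 `|` H1) `|` ~` (K0 `|` H0)) `|` A))).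
  by apply: le_measure sub; rewrite inE//; exact: measurableU.
apply: (@le_lt_trans _ _ (m (~` (K1 `|` H1) `|` ~` (K0 `|` H0)) + m A)%E).
  exact: measureU2.
rewrite A0 adde0.
apply: (@le_lt_trans _ _ (m (~` (K1 `|` H1)) + m (~` (K0 `|` H0)))%E).
  exact: measureU2.
by rewrite [e in ltRHS]splitr EFinD lteD.
Qed.

(* Two points at zero gap lie on a common ray. *)
Lemma ray_gap (N E K1 K0 : set T) : ray_invariant N E ->
  compact K1 -> compact K0 -> K1 `<=` E `\` N -> K0 `<=` ~` E `\` N ->
  exists2 d : R, 0 < d &
    forall x y, K0 x -> K1 y -> d <= mdist x y - v x + v y.
Proof.
move=> iE cK1 cK0 KE1 KE0.
have [K01|K01] := pselect ((K0 `*` K1) !=set0); last first.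
  by exists 1 => // x y K0x K1y; exfalso; apply: K01; exists (x, y).
pose c (p : T * T) := mdist p.1 p.2 - v p.1 + v p.2.
have cv := lip1_continuous lv.
have cc : continuous c.
  move=> p; apply: cvgD; first apply: cvgB.
  - exact: continuous_mdist.
  - by apply: (cvg_comp fst v); [exact: cvg_fst|exact: cv].
  - by apply: (cvg_comp snd v); [exact: cvg_snd|exact: cv].
have [[x y] /set_mem[/= K0x K1y] cmin] :=
  compact_EVT_min K01 (compact_setX cK0 cK1) (continuous_subspaceT cc).
exists (c (x, y)); last first.
  by move=> x' y' K0x' K1y'; apply: (cmin (x', y')); rewrite inE.
have c_ge0 : 0 <= c (x, y).
  by rewrite /c/=; have := lip1_le x y lv; lra.
(* A zero minimum would tie a point of [K0] to a point of [K1] by an equality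
   [v x - v y = mdist x y], against the invariance of [E]. *)
rewrite lt_neqAle c_ge0 andbT eq_sym; apply/negP => /eqP; rewrite /c /= => c0.
have [Ey Ny] := KE1 _ K1y; have [nEx Nx] := KE0 _ K0x.
apply: nEx; apply: (iE y x) => //.
have dE : mdist x y = v x - v y by lra.
by rewrite distrC metric_sym dE ger0_norm// -dE mdist_ge0.
Qed.

Lemma L1_indic (E : set (borel T)) : measurable E -> L1 m \1_E.
Proof.
move=> mE; apply: (@L1_bounded _ _ _ _ 1); first exact: measurable_indic.
by move=> x; rewrite indicE; case: (_ \in _); rewrite ?normr1 ?normr0.
Qed.

Lemma cl_coneF_indic (N E : set (borel T)) : m.-negligible N -> measurable E ->
  ray_invariant N E -> cl m (coneF m v) \1_E.
Proof.
move=> nN mE iE; have LE := L1_indic mE; apply/clE; split => // e e0.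
have [K1 [K0 [cK1 cK0 KE1 KE0 mK]]] := compact_split nN mE e0.
have [d d0 hd] := ray_gap iE cK1 cK0 KE1 KE0.
have [u [lu uv u1 u0]] := lip1_urysohn lv d0 hd.
(* This element of the cone agrees with the indicator on [K1] and [K0]. Elsewhere the two differ by
   at most 1, so their distance is at most the measure of [D]. *)
pose g (x : borel T) := d^-1 * (v x - u x).
have g01 x : 0 <= g x <= 1.
  have /andP[h1 h2] := uv x; rewrite /g mulr_ge0 ?invr_ge0 ?subr_ge0 ?(ltW d0)//=.
  by rewrite mulrC ler_pdivrMr// mul1r; lra.
have mg : measurable_fun setT g.
  apply: measurable_funM => //; apply: measurable_funB;
  by apply: continuous_borel_measurable; exact: lip1_continuous.
have Lg : L1 m g.
  apply: (@L1_bounded _ _ _ _ 1) => // x.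
  by have /andP[g0 g1] := g01 x; rewrite ger0_norm.
exists g.
  split => //; exists d^-1, u; split => //; first by rewrite invr_ge0 ltW.
  exact: aeW.
pose D : set (borel T) := ~` (K1 `|` K0).
have mD : measurable D.
  by apply: measurableC; apply: measurableU; exact: borel_compact.
apply: le_lt_trans mK; rewrite -/D -[X in m X]setIT -integral_indic//.
apply: ge0_le_integral => //.
- by apply: measurable_dist => //; exact: measurable_indic.
- by apply/measurable_EFinP; exact: measurable_indic.
move=> x _; rewrite lee_fin.
have [K1x|nK1x] := pselect (K1 x).
  rewrite (_ : \1_E x - g x = 0) ?normr0 ?indicE//.
  have [Ex _] := KE1 _ K1x; rewrite mem_set// /g u1//.
  have -> : v x - (v x - d) = d by ring.
  by rewrite mulVf ?gt_eqF// subrr.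
have [K0x|nK0x] := pselect (K0 x).
  rewrite (_ : \1_E x - g x = 0) ?normr0 ?indicE//.
  have [Ex _] := KE0 _ K0x; rewrite memNset// /g u0//.
  by rewrite subrr mulr0 subrr.
rewrite (_ : \1_D x = 1); last by rewrite indicE mem_set// => -[].
rewrite indicE ler_norml; have /andP[h1 h2] := g01 x.
by case: (_ \in _); rewrite /=; apply/andP; split; lra.
Qed.

Lemma spaceB_indic (N E : set (borel T)) : m.-negligible N -> measurable E ->
  ray_invariant N E -> spaceB m v \1_E.
Proof.
move=> nN mE iE; split; first exact: cl_coneF_indic iE.
(* The complement is ray-invariant too, and constants of either sign lie in the cone. *)
rewrite /opp_set/= (_ : \- _ = \1_(~` E) \+ cst (- 1)).
  apply: cl_coneFD => //.
    by apply: cl_coneF_indic (ray_invariantC iE) => //; exact: measurableC.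
  by apply: sub_cl; [exact: coneF_L1|exact: coneF_cst].
apply/funext => x; rewrite /= !indicE in_setC.
by case: (_ \in _) => /=; lra.
Qed.

(* Halving step: [f - c / 2 * \1_{f >= c / 2}] takes values in [[0, c / 2]]. *)
Lemma ray_constant_dyadic (N : set (borel T)) (k : nat) (f : borel T -> R) (c : R) :
  m.-negligible N -> measurable_fun setT f -> ray_constant v N f ->
  (forall x, 0 <= f x <= c) ->
  exists2 g, spaceB m v g & forall x, `|f x - g x| <= c / 2 ^+ k.
Proof.
move=> nN; elim: k f c => [|k IH] f c mf cf fc.
  exists (cst 0); first exact: spaceB_cst.
  by move=> x; rewrite subr0 expr0 divr1; have /andP[? ?] := fc x; rewrite ger0_norm.
pose E : set (borel T) := f @^-1` `[c / 2, +oo[.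
have mE : measurable E by rewrite -[E]setTI; exact: mf.
have Ex x : (x \in E) = (c / 2 <= f x).
  by apply/idP/idP; rewrite inE /E/= in_itv/= andbT.
have iE : ray_invariant N E.
  by move=> x y Nx Ny vxy; rewrite /E/= (cf x y).
have [||x|g Bg fg] := IH (fun x => f x - c / 2 * \1_E x) (c / 2).
- by apply: measurable_funB => //; apply: measurable_funM => //; exact: measurable_indic.
- move=> x y Nx Ny vxy; congr (_ - _ * _); first exact: cf.
  by rewrite !indicE !Ex (cf x y).
- have /andP[h1 h2] := fc x; rewrite indicE Ex.
  by have [h|h] := leP (c / 2) (f x); rewrite /=; apply/andP; split; lra.
exists (g \+ (fun x => c / 2 * \1_E x)).
  apply: spaceBD => //; apply: spaceBZ => //; exact: spaceB_indic iE.
move=> x; rewrite exprS invfM mulrA /=.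
have -> : f x - (g x + c / 2 * \1_E x) = f x - c / 2 * \1_E x - g x by ring.
exact: fg.
Qed.

Lemma spaceB_bounded (N : set (borel T)) (f : borel T -> R) (c : R) :
  m.-negligible N -> measurable_fun setT f -> ray_constant v N f ->
  (forall x, `|f x| <= c) -> spaceB m v f.
Proof.
move=> nN mf cf fc; have Lf := L1_bounded m mf fc.
apply: spaceB_closed => // e e0.
pose M := fine (m setT).
have M0 : 0 <= M by exact: fine_ge0.
have mM : m setT = M%:E by rewrite fineK// fin_num_measure.
have c0 : 0 <= c by apply: le_trans (fc point); exact: normr_ge0.
have [k hk] : exists k, 2 * c / 2 ^+ k * M < e.
  (* The added 1 keeps the denominator positive when [c] or [M] vanishes. *)
  have h : 0 < e / (2 * c * M + 1) by rewrite divr_gt0// ltr_wpDl// !mulr_ge0.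
  have [k _ /(_ k (leqnn k))] := near_infty_natSinv_expn_lt (PosNum h).
  rewrite /= ltr_pdivlMr ?ltr_wpDl ?mulr_ge0// => hk; exists k.
  apply: le_lt_trans hk.
  rewrite mulrAC [leRHS]mulrC div1r ler_wpM2r ?invr_ge0 ?exprn_ge0//.
  by rewrite lerDl.
(* Adding [c] moves the values into [[0, 2c]], where the dyadic approximation applies; the constant
   is subtracted again afterwards. *)
have [||x|g Bg fg] := @ray_constant_dyadic N k (fun x => f x + c) (2 * c) nN.
- exact: measurable_funD.
- by move=> x y Nx Ny vxy; rewrite (cf x y).
- have := fc x; rewrite ler_norml => /andP[h1 h2].
  by apply/andP; split; lra.
exists (g \+ cst (- c)); first by apply: spaceBD => //; exact: spaceB_cst.
apply: (@le_lt_trans _ _ (2 * c / 2 ^+ k * M)%:E); last by rewrite lte_fin.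
rewrite EFinM -mM -integral_cst//; apply: ge0_le_integral => //.
- apply: measurable_dist => //; apply: measurable_funD => //.
  by apply: (@L1_measurable _ _ m); exact: spaceB_L1 Bg.
- move=> x _ /=; rewrite lee_fin.
  by have -> : f x - (g x - c) = f x + c - g x by ring.
Qed.

(** The truncations [t k] are bounded and constant on rays off [N]. They converge to [f] in mean by
    domination by [|f|], and the lineality space is closed. *)
Lemma spaceA_sub_spaceB : spaceA m v `<=` spaceB m v.
Proof.
move=> f /spaceA_ray_constant[Lf [N nN cf]]; apply: spaceB_closed => // e e0.
have mf := L1_measurable Lf.
pose t k (x : borel T) := Num.max (- k%:R) (Num.min (f x) k%:R).
have mt k : measurable_fun setT (t k).
  by apply: measurable_maxr => //; exact: measurable_minr.
have tk k x : `|t k x| <= k%:R.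
  have k0 : 0 <= k%:R :> R by [].
  by rewrite ler_norml /t le_max lexx/= ge_max ge_min lexx orbT andbT; lra.
have Bt k : spaceB m v (t k).
  apply: (spaceB_bounded nN _ _ (tk k)) => //.
  by move=> x y Nx Ny vxy; rewrite /t (cf x y).
have ft k x : `|f x - t k x| <= `|f x|.
  rewrite /t; have k0 : 0 <= k%:R :> R by [].
  have [h1|h1] := leP (f x) k%:R.
    have [h2|h2] := leP (- k%:R) (f x); first by rewrite subrr normr0.
    by rewrite ler_norml; have [h3|h3] := ger0P (f x); apply/andP; split; lra.
  rewrite max_r; last by lra.
  by rewrite ler_norml; have [h3|h3] := ger0P (f x); apply/andP; split; lra.
have h : (fun k => L1dist m f (t k)) @ \oo --> 0%E.
  rewrite -(integral0 m setT).
  apply: (@dominated_cvg _ _ _ m setT measurableT _ (cst 0%E) (fun x => `|f x|%:E)) => //.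
  - by move=> k; exact: measurable_dist.
  - move=> x _; apply: (@cvg_near_cst _ _ _ _ _).
    near=> k; have fk : `|f x| <= k%:R by near: k; exact: nbhs_infty_ger.
    move: fk; rewrite ler_norml => /andP[h1 h2].
    by rewrite /t (min_idPl h2) (max_idPr h1) subrr normr0.
  - by apply/L1_integrable; exact: Lfun_norm.
  - by move=> k x _; rewrite /= lee_fin normr_id.
have /fine_cvgP[[k1 _ hk1] /cvgrPdist_lt /(_ _ e0)[k2 _ hk2]] := h.
pose k := maxn k1 k2.
have := hk2 k (leq_maxr _ _); rewrite /= sub0r normrN => hk.
exists (t k) => //; rewrite -[ltLHS]fineK; last exact: hk1 (leq_maxl _ _).
by rewrite lte_fin; exact: le_lt_trans (ler_norm _) hk.
Unshelve. all: by end_near. Qed.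

End spaceA_sub_spaceB.

(** * Elements of the cone are monotone along rays *)

Section spaceA_closed.
Context (R : realType) (T : pmetricType R).
Variables (m : {finite_measure set (borel T) -> \bar R}) (v : T -> R).

(** Each term is at most the tail starting at it, and the tails tend to 0. *)
Lemma nneseries_fin_lt (u : (\bar R)^nat) (e : R) : (forall k, 0 <= u k)%E ->
  (\sum_(k <oo) u k < +oo)%E -> 0 < e -> \forall k \near \oo, (u k < e%:E)%E.
Proof.
move=> u0 us e0.
have /fine_cvgP[h1 /cvgrPdist_lt /(_ _ e0) h2] :=
  nneseries_tail_cvg us (fun k _ => u0 k).
near=> k.
have tk : (\sum_(k <= j <oo) u j)%E \is a fin_num by near: k.
apply: (@le_lt_trans _ _ (\sum_(k <= j <oo) u j)%E).
  apply: le_trans (nneseries_lim_ge k.+1 (fun n _ _ => u0 n)).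
  by rewrite big_nat1.
rewrite -[ltLHS]fineK// lte_fin; apply: le_lt_trans (ler_norm _) _.
by rewrite -normrN -sub0r; near: k.
Unshelve. all: by end_near. Qed.

(** By monotone convergence the sum of the pointwise distances has finite integral, hence is finite
    almost everywhere. *)
Lemma summable_L1dist_ae (f : borel T -> R) (g : nat -> borel T -> R) : L1 m f ->
  (forall k, L1 m (g k)) -> (\sum_(k <oo) L1dist m f (g k) < +oo)%E ->
  {ae m, forall x, (\sum_(k <oo) `|f x - g k x|%:E < +oo)%E}.
Proof.
move=> Lf Lg fg; pose h k (x : borel T) := `|f x - g k x|%:E.
have mh k : measurable_fun setT (h k).
  by apply: measurable_dist; [exact: L1_measurable Lf|exact: L1_measurable (Lg k)].
have ih : m.-integrable setT (fun x => \sum_(k <oo) h k x)%E.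
  apply/integrableP; split.
    by apply: ge0_emeasurable_sum => // k x _ _; rewrite lee_fin.
  under eq_integral => x _.
    rewrite gee0_abs; last by apply: nneseries_ge0 => k _ _; rewrite lee_fin.
    over.
  by rewrite integral_nneseries// => k x _; rewrite lee_fin.
by apply: filterS (integrable_ae measurableT ih) => x /(_ I); rewrite fin_numElt => /andP[].
Qed.

Lemma cl_spaceA : cl m (spaceA m v) `<=` spaceA m v.
Proof.
move=> f /clE[Lf hf]; apply/spaceA_ray_constant; split => //.
(* Geometric rates make the distances summable, so [g k] tends to [f] pointwise off the null set
   [N']. Countably many exceptional sets are then merged into one. *)
have /choice[g hg] : forall k, exists g : borel T -> R, spaceA m v g /\
    (L1dist m f g < (1 / (2 ^ k.+1)%:R)%:E)%E.
  move=> k; have [|g] := hf (1 / (2 ^ k.+1)%:R).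
    by rewrite divr_gt0// ltr0n expn_gt0.
  by exists g.
have Lg k : L1 m (g k) by case: (hg k) => -[].
have sg : (\sum_(k <oo) L1dist m f (g k) < +oo)%E.
  apply: (@le_lt_trans _ _ 1%:E); last exact: ltry.
  apply: le_trans (epsilon_trick0 xpredT ler01).
  apply: lee_nneseries => [k _ _|k _]; first exact: integral_ge0.
  by case: (hg k) => _ /ltW.
have /choice[N hN] : forall k, exists N : set (borel T),
    m.-negligible N /\ ray_constant v N (g k).
  by move=> k; have [/spaceA_ray_constant[_ [N nN cN]] _] := hg k; exists N.
pose N' := ~` [set x | (\sum_(k <oo) `|f x - g k x|%:E < +oo)%E].
exists (\bigcup_k N k `|` N').
  apply: negligibleU; last exact: summable_L1dist_ae.
  by apply: negligible_bigcup => k; case: (hN k).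
move=> x y; rewrite !not_orP => -[Nx /contrapT sx] [Ny /contrapT sy] vxy.
apply/eqP/negPn/negP => fxy.
(* If [f x] and [f y] differed, a common value [g k x = g k y] within [e] of both would break the
   triangle inequality. *)
pose e := `|f x - f y| / 2.
have e0 : 0 < e by rewrite divr_gt0// normr_gt0 subr_eq0.
have pos z k : (0 <= `|f z - g k z|%:E)%E by rewrite lee_fin.
have [k [hx hy]] : exists k, (`|f x - g k x| < e) /\ (`|f y - g k y| < e).
  near \oo => k; exists k; rewrite -!lte_fin; split; near: k.
    exact: (nneseries_fin_lt (pos x)).
  exact: (nneseries_fin_lt (pos y)).
have gxy : g k x = g k y.
  by case: (hN k) => _; apply => // Nk; [apply: Nx|apply: Ny]; exists k.
have := ler_distD (g k x) (f x) (f y); rewrite {2}gxy (distrC (g k y)).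
by rewrite leNgt => /negP; apply; rewrite [ltRHS]splitr ltrD.
Unshelve. all: by end_near. Qed.

(** Along the pair [v] drops by the full distance and [u] by no more, so [v - u] is no smaller at
    [x] than at [y]. *)
Lemma coneF_ae_le f : coneF m v f -> exists2 N, m.-negligible N &
  forall x y, ~ N x -> ~ N y -> v x - v y = mdist x y -> f y <= f x.
Proof.
move=> [Lf [l [u [l0 lu fE]]]].
exists (~` [set x | setT x -> f x = l * (v x - u x)]); first exact: fE.
move=> x y /contrapT/(_ I) -> /contrapT/(_ I) -> vxy.
by rewrite ler_wpM2l//; have := lip1_le x y lu; lra.
Qed.

Lemma coneF_opp_sub_spaceA : coneF m v `&` opp_set (coneF m v) `<=` spaceA m v.
Proof.
move=> f [Ff FNf]; apply/spaceA_ray_constant; split; first exact: coneF_L1 Ff.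
have [N1 nN1 h1] := coneF_ae_le Ff; have [N2 nN2 h2] := coneF_ae_le FNf.
exists (N1 `|` N2); first exact: negligibleU.
(* By symmetry [v x] may be taken as the larger value; monotonicity of [f] and of [- f] then gives
   both inequalities. *)
suff h x y : ~ (N1 `|` N2) x -> ~ (N1 `|` N2) y -> v x - v y = mdist x y ->
    f x = f y.
  move=> x y Nx Ny; have [v0|v0] := leP (v y) (v x).
    by rewrite ger0_norm ?subr_ge0//; exact: h.
  rewrite ltr0_norm ?subr_lt0// opprB metric_sym => vyx.
  by apply/esym; exact: h.
rewrite !not_orP => -[N1x N2x] [N1y N2y] vxy.
apply/le_anti/andP; split; last exact: h1.
by have := h2 _ _ N2x N2y vxy; rewrite lerN2.
Qed.

Lemma clS (S S' : set (borel T -> R)) : S `<=` S' -> cl m S `<=` cl m S'.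
Proof. by move=> SS' f [Lf h]; split => // e /h[g /SS']; exists g. Qed.

End spaceA_closed.

(** * Application to the sum of the two probability measures *)

Lemma finite_measure_of_fin_num d (T : measurableType d) (R : realType)
    (m : {measure set T -> \bar R}) : fin_num_fun m ->
  exists m' : {finite_measure set T -> \bar R}, (m' : {measure set T -> \bar R}) = m.
Proof.
move=> fin; have sf : sigma_finite setT m.
  by apply: fin_num_fun_sigma_finite => //; rewrite measure0.
pose h1 := isFinite.Build _ _ _ _ fin.
pose h2 := isSFinite.Build _ _ _ _ (sfinite_measure_sigma_finite sf).
pose h3 := isSigmaFinite.Build _ _ _ _ sf.
exists (HB.pack_for (FiniteMeasure.type T R) (Measure.sort m) h1 h2 h3).
exact: eq_measure.
Qed.

Theorem proposition10p1 (R : realType) (n : nat) (T : pmetricType R)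
    (M : riemannian_manifold n T)
    (vol : {measure set (borel T) -> \bar R}) (hvol : riemannian_volume M vol)
    (mu nu : probability (borel T) R)
    (mu_ac : mu `<< vol) (nu_ac : nu `<< vol)
    (w0 : T)
    (mu_moment : (\int[mu]_x (mdist (x : T) w0)%:E < +oo)%E)
    (nu_moment : (\int[nu]_x (mdist (x : T) w0)%:E < +oo)%E)
    (v : T -> R) (hv : optimal_potential mu nu v) :
  let m := measure_add mu nu in
  spaceA m v `<=` spaceB m v /\
  cl m (coneF m v `&` opp_set (coneF m v)) `<=` spaceA m v.
Proof.
move=> m; have [lv _] := hv.
have fin : fin_num_fun m.
  by move=> A mA; rewrite /m measure_addE fin_numD !fin_num_measure.
(* The sum is replaced by an equal measure carrying the finite measure structure on which the
   preceding results rely. *)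
have [m' <-] := finite_measure_of_fin_num fin.
split; first exact: (spaceA_sub_spaceB (manifold_sigma_compact M) lv).
(* As [spaceA] is closed, it is enough to place the intersection itself in it. *)
apply: subset_trans (@cl_spaceA _ _ m' _).
by apply: (@clS _ _ m'); exact: (@coneF_opp_sub_spaceA _ _ m').
Qed.
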